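(* Let $h\colon[0,\infty)\to[0,\infty)$ be a measurable function such that $h(t)\to\infty$ as $t\to\infty$. Let $Q$ be a cube in $\mathbb{R}^n$ and let $\varphi\in L^1(Q)$ be such that $K_{h,Q}(\varphi)<\infty$. Then $\varphi\in\mathrm{BMO}(Q)$.
   Context: All cubes have sides parallel to the coordinate axes and finite positive measure; functions are real-valued. $\langle\varphi\rangle_E=\frac1{|E|}\int_E\varphi$ for measurable $E$ with $0<|E|<\infty$. For a non-negative function $h$ on $[0,\infty)$ and $\varphi$ integrable on $Q$, $$K_{h,Q}(\varphi)=\sup_{J}\ \langle h(|\varphi-\langle\varphi\rangle_J|)\rangle_J,$$ the supremum over all subcubes $J$ of $Q$; the condition $K_{h,Q}(\varphi)<\infty$ presupposes that the functions $h(|\varphi-\langle\varphi\rangle_J|)$ being averaged are measurable. $\varphi\in\mathrm{BMO}(Q)$ means that $\varphi\in L^1(Q)$ and $\sup_J\langle|\varphi-\langle\varphi\rangle_J|\rangle_J<\infty$, the supremum over all subcubes $J$ of $Q$ (equivalently, $\sup_J\langle|\varphi-\langle\varphi\rangle_J|^2\rangle_J<\infty$). *)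

(* Defs.v *)
From HB Require Import structures.
From mathcomp Require Import all_boot all_order all_algebra.
From mathcomp Require Import all_classical all_reals all_analysis.
From mathcomp Require Import measurable_realfun.

Set Implicit Arguments.
Unset Strict Implicit.
Unset Printing Implicit Defensive.
Import Order.TTheory GRing.Theory Num.Theory.
Import numFieldNormedType.Exports.

Local Open Scope classical_set_scope.
Local Open Scope ring_scope.

(* R^d with d >= 1 is 'rV[R]_n.+1 (d = n + 1) throughout.  Excluding d = 0 is
   needed for outer_lebesgue set0 = 0: in dimension 0 every box is the whole
   space and has volume 1. *)

Section outer_lebesgue.
Context {R : realType} {n : nat}.

Definition box (p : 'rV[R]_n.+1 * 'rV[R]_n.+1) : set 'rV[R]_n.+1 :=
  [set x | forall i, x ord0 i \in `]p.1 ord0 i, p.2 ord0 i]].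

Definition box_volume (p : 'rV[R]_n.+1 * 'rV[R]_n.+1) : R :=
  \prod_(i < n.+1) Num.max 0 (p.2 ord0 i - p.1 ord0 i).

Definition box_cover (X : set 'rV[R]_n.+1) :
    set (nat -> 'rV[R]_n.+1 * 'rV[R]_n.+1) :=
  [set p | X `<=` \bigcup_k box (p k)].

Definition outer_lebesgue (X : set 'rV[R]_n.+1) : \bar R :=
  ereal_inf [set (\sum_(k <oo) (box_volume (p k))%:E)%E | p in box_cover X].

Let box_volume_ge0 p : (0 <= (box_volume p)%:E)%E.
Proof.
by rewrite lee_fin; apply: prodr_ge0 => i _; rewrite le_max lexx.
Qed.

Let outer_lebesgue_ge0 X : (0 <= outer_lebesgue X)%E.
Proof. by apply: le_ereal_inf_tmp => _ [p _ <-]; exact: nneseries_ge0. Qed.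

Let outer_lebesgue0 : outer_lebesgue set0 = 0%E.
Proof.
apply/eqP; rewrite eq_le outer_lebesgue_ge0 andbT.
apply: ereal_inf_lbound; exists (fun=> (0, 0)) => //.
rewrite eseries0// => k _ _.
by rewrite /box_volume big_ord_recl /= !mxE subrr maxxx mul0r.
Qed.

Let le_outer_lebesgue :
  {homo outer_lebesgue : A B / A `<=` B >-> (A <= B)%E}.
Proof.
move=> A B AB; apply/ereal_inf_le_tmp => _ [p Bp <-]; exists p => //.
exact: subset_trans Bp.
Qed.

Let outer_lebesgue_sigma_subadditive : sigma_subadditive outer_lebesgue.
Proof.
move=> A; have [[i ioo]|] := pselect (exists i, outer_lebesgue (A i) = +oo%E).
  rewrite (eseries_pinfty _ _ ioo) ?leey// => k _.
  by rewrite -ltNye (lt_le_trans _ (outer_lebesgue_ge0 _)).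
rewrite -forallNE => Aoo.
suff add2e (e : {posnum R}) : (outer_lebesgue (\bigcup_k A k) <=
    \sum_(i <oo) outer_lebesgue (A i) + e%:num%:E)%E.
  by apply/lee_addgt0Pr => _/posnumP[].
rewrite (le_trans _ (epsilon_trick _ _ _))//.
pose P k (p : nat -> 'rV[R]_n.+1 * 'rV[R]_n.+1) := box_cover (A k) p /\
  (\sum_(j <oo) (box_volume (p j))%:E <=
   outer_lebesgue (A k) + (e%:num / (2 ^ k.+1)%:R)%:E)%E.
have [G PG] : {G : nat -> nat -> 'rV[R]_n.+1 * 'rV[R]_n.+1 &
    forall k, P k (G k)}.
  apply: (@choice _ _ P) => k.
  have en1 : 0 < e%:num / (2 ^ k.+1)%:R by [].
  have Afin : outer_lebesgue (A k) \is a fin_num.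
    by rewrite ge0_fin_numE// ltey; apply/eqP; exact: Aoo.
  have [_ [p Ap <-] /ltW px] := lb_ereal_inf_adherent en1 Afin.
  by exists p.
pose v x := (box_volume (uncurry G x))%:E.
have v_ge0 x : (0 <= v x)%E by exact: box_volume_ge0.
apply: (@le_trans _ _ (\esum_(i in setT) v i)%E).
  apply: ereal_inf_lbound => /=.
  have /card_esym/ppcard_eqP[f] := card_nat2.
  exists (uncurry G \o f).
    move=> t [i _ /(PG i).1 [j _ tij]].
    by exists (f^-1%FUN (i, j)) => //=; rewrite invK ?inE.
  rewrite -(esum_pred_image v _ xpredT) ?[fun=> _]set_true//.
  by rewrite image_eq.
rewrite (_ : esum _ _ =
    \sum_(i <oo) \sum_(j <oo) (box_volume (G i j))%:E)%E; last first.
  pose J : nat -> set (nat * nat) := fun i => [set (i, j) | j in setT].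
  rewrite (_ : setT = \bigcup_k J k); last first.
    by rewrite predeqE => -[a b]; split => // _; exists a => //; exists b.
  rewrite esum_bigcupT /=; last 2 first.
    - apply/trivIsetP => i j _ _ ij.
      rewrite predeqE => -[k m] /=; split => //= -[] [_] _ [<-{k} _].
      by move=> [m' _] [] /esym/eqP; rewrite (negbTE ij).
    - by move=> x; exact: v_ge0.
  rewrite -(image_id [set: nat]) -fun_true esum_pred_image//; last first.
    by move=> k _; exact: esum_ge0.
  apply: eq_eseriesr => /= j _.
  rewrite -(esum_pred_image v (pair j) predT)//=; last first.
    by move=> ? ? _ _; exact: (@can_inj _ _ _ snd).
  by congr esum; rewrite predeqE => -[a b]; split; move=> [i _ <-]; exists i.
apply: lee_lim.
- by apply: is_cvg_nneseries => k *; exact: nneseries_ge0.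
- by apply: is_cvg_nneseries => k *; exact: adde_ge0.
- by apply: nearW => k; apply: lee_sum => i _; exact: (PG i).2.
Qed.

HB.instance Definition _ := isOuterMeasure.Build R 'rV[R]_n.+1 outer_lebesgue
  outer_lebesgue0 outer_lebesgue_ge0 le_outer_lebesgue
  outer_lebesgue_sigma_subadditive.

End outer_lebesgue.
Arguments outer_lebesgue : clear implicits.

(* R^(n+1) with the sigma-algebra of Lebesgue (not merely Borel) measurable
   sets. *)
Definition lebesgue_space (R : realType) (n : nat) :=
  caratheodory_type (outer_lebesgue R n).

HB.instance Definition _ (R : realType) (n : nat) :=
  Measurable.on (lebesgue_space R n).

Definition lebesgue_mx {R : realType} {n : nat} :
  set (lebesgue_space R n) -> \bar R := outer_lebesgue R n.

HB.instance Definition _ (R : realType) (n : nat) :=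
  isMeasure.Build _ _ _ (@lebesgue_mx R n)
    (@caratheodory_measure0 _ _ (outer_lebesgue R n))
    (@caratheodory_measure_ge0 _ _ (outer_lebesgue R n))
    (@caratheodory_measure_sigma_additive _ _ (outer_lebesgue R n)).

(* The real line with the Lebesgue measurable sets. *)
Definition lebesgue_line (R : realType) :=
  g_sigma_algebraType (completed_algebra_gen (@lebesgue_measure R)).

HB.instance Definition _ (R : realType) := Measurable.on (lebesgue_line R).

Section bmo.
Context {R : realType} {n : nat}.
Implicit Types (Q J E : set (lebesgue_space R n)).
Implicit Types (phi : lebesgue_space R n -> R).

(* Each face may or may not belong to the cube, so that open, closed and
   half-open cubes are all covered. *)
Definition is_cube Q := exists (a : 'rV[R]_n.+1) (l : R) (s t : 'I_n.+1 -> bool),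
  0 < l /\ Q = [set x : 'rV[R]_n.+1 | forall i,
    x ord0 i \in Interval (BSide (s i) (a ord0 i)) (BSide (t i) (a ord0 i + l))].

Definition subcubes Q := [set J | is_cube J /\ J `<=` Q].

Definition average (f : lebesgue_space R n -> \bar R) E : \bar R :=
  ((lebesgue_mx E)^-1 * \int[lebesgue_mx]_(x in E) f x)%E.

Definition mean phi E : R := fine (average (EFin \o phi) E).

(* h is only ever evaluated on [0, +oo[. *)
Definition osc (h : R -> R) phi J : lebesgue_space R n -> R :=
  fun x => h `|phi x - mean phi J|.

Definition K (h : R -> R) Q phi : \bar R :=
  ereal_sup [set average (EFin \o osc h phi J) J | J in subcubes Q].

(* For non-measurable integrands the integral is a junk value, hence the
   separate measurability clause. *)
Definition K_finite (h : R -> R) Q phi : Prop :=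
  (forall J, subcubes Q J -> measurable_fun J (osc h phi J)) /\
  (K h Q phi < +oo)%E.

Definition L1 Q phi : Prop := lebesgue_mx.-integrable Q (EFin \o phi).

Definition BMO Q phi : Prop :=
  L1 Q phi /\
  (ereal_sup [set average (fun x => `|phi x - mean phi J|%:E) J
             | J in subcubes Q] < +oo)%E.

End bmo.

(* Main.v *)
(* John-Stromberg argument. Since h tends to infinity, Chebyshev's
   inequality gives T such that |phi - phi_J| > T on at most a fraction eps
   of every subcube J, with eps as small as we please. Given J, let S be the
   exceptional set of J and stop at the maximal dyadic subcubes J' of J on
   which S has density more than theta. The parent of J' has density at most
   theta, so S fills at most half of J'; as the exceptional set of J' is
   small too, some point of J' is in neither, whence |phi_J' - phi_J| <= 2T.
   The total measure of the J' is at most (eps / theta) |J| <= |J| / 2, and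
   induction on k yields |{x in J : |phi - phi_J| > 2Tk}| <= 2^-k |J|;
   summing over k bounds the mean oscillation by 4T.

   Lebesgue's differentiation theorem is replaced by a covering argument: a
   set of density at most theta in every dyadic subcube satisfies |N| <= 3^d
   theta |N|, hence is null. Only upper bounds on the measure of boxes and
   comparisons between cubes are needed, never the measure of a cube. *)

Require Import Defs.
From HB Require Import structures.
From mathcomp Require Import all_boot all_order all_algebra.
From mathcomp Require Import all_classical all_reals all_analysis.
From mathcomp Require Import measurable_realfun.
From mathcomp Require Import lra.

Set Implicit Arguments.
Unset Strict Implicit.
Unset Printing Implicit Defensive.
Import Order.TTheory GRing.Theory Num.Theory.
Import numFieldNormedType.Exports.

Local Open Scope classical_set_scope.
Local Open Scope ring_scope.

(** * Measurability and translation invariance *)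

Section outer_lebesgue_basics.
Context {R : realType} {n : nat}.
Implicit Types (p : 'rV[R]_n.+1 * 'rV[R]_n.+1) (X : set 'rV[R]_n.+1).

Lemma box_volume_ge0 p : 0 <= box_volume p.
Proof. by apply: prodr_ge0 => i _; rewrite le_max lexx. Qed.

Lemma outer_lebesgue_box p :
  (outer_lebesgue R n (box p) <= (box_volume p)%:E)%E.
Proof.
apply: ereal_inf_lbound.
(* The cover is padded with empty boxes of volume 0. *)
exists (fun k => if k == 0%N then p else (0, 0)).
  by move=> x px; exists 0%N.
rewrite (@nneseries_split _ _ 0 1)//; last first.
  by move=> k _; rewrite lee_fin box_volume_ge0.
rewrite add0n big_nat1/= eseries0 ?adde0// => -[//|k] _ _.
by rewrite /box_volume big_ord_recl /= !mxE subrr maxxx mul0r.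
Qed.

Let outer_lebesgue_translate_le X (v : 'rV[R]_n.+1) :
  (outer_lebesgue R n [set x + v | x in X]%R <= outer_lebesgue R n X)%E.
Proof.
apply: le_ereal_inf_tmp => _ [p Xp <-].
apply: ereal_inf_lbound; exists (fun k => ((p k).1 + v, (p k).2 + v)).
  move=> _ [x /Xp[k _ pkx] <-]; exists k => // i /=.
  by move: (pkx i); rewrite !mxE !in_itv/= ltrD2r lerD2r.
apply: eq_eseriesr => k _; congr EFin; apply: eq_bigr => i _ /=.
by rewrite !mxE opprD addrACA subrr addr0.
Qed.

Lemma outer_lebesgue_translate X (v : 'rV[R]_n.+1) :
  outer_lebesgue R n [set x + v | x in X] = outer_lebesgue R n X.
Proof.
apply/eqP; rewrite eq_le outer_lebesgue_translate_le/=.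
rewrite -{1}(_ : [set x - v | x in [set x + v | x in X]] = X).
  exact: outer_lebesgue_translate_le.
apply/seteqP; split=> [_ [_ [x Xx <-] <-]|x Xx]; first by rewrite addrK.
by exists (x + v); [exists x|rewrite addrK].
Qed.

(** When the hyperplane misses the box, one piece is the whole box and the other gets a nonpositive
    edge, which [box_volume] truncates to 0. *)
Definition box_cut_below p (i : 'I_n.+1) (c : R) :=
  (p.1, \row_j if j == i then Num.min c (p.2 ord0 j) else p.2 ord0 j).

Definition box_cut_above p (i : 'I_n.+1) (c : R) :=
  (\row_j (if j == i then Num.max c (p.1 ord0 j) else p.1 ord0 j), p.2).

Lemma box_volume_cut p i c :
  box_volume (box_cut_above p i c) + box_volume (box_cut_below p i c) =
  box_volume p.
Proof.
rewrite /box_volume (bigD1 i)//= [X in _ + X](bigD1 i)//= [RHS](bigD1 i)//=.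
rewrite !mxE eqxx.
have E1 : \prod_(j < n.+1 | j != i) Num.max 0 (p.2 ord0 j -
    (\row_j (if j == i then Num.max c (p.1 ord0 j) else p.1 ord0 j)) ord0 j) =
    \prod_(j < n.+1 | j != i) Num.max 0 (p.2 ord0 j - p.1 ord0 j).
  by apply: eq_bigr => j /negPf ji; rewrite mxE ji.
have E2 : \prod_(j < n.+1 | j != i) Num.max 0 (
    (\row_j if j == i then Num.min c (p.2 ord0 j) else p.2 ord0 j) ord0 j -
      p.1 ord0 j) =
    \prod_(j < n.+1 | j != i) Num.max 0 (p.2 ord0 j - p.1 ord0 j).
  by apply: eq_bigr => j /negPf ji; rewrite mxE ji.
rewrite E1 E2 -mulrDl; congr (_ * _).
rewrite /Num.max /Num.min; do ?case: ifPn; rewrite -?leNgt => *; lra.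
Qed.

(** Caratheodory's criterion: cutting each box of a cover of [X] along the hyperplane covers both
    pieces of [X] with the same total volume. *)
Lemma measurable_halfspace_gt (i : 'I_n.+1) (c : R) :
  measurable ([set x : 'rV[R]_n.+1 | c < x ord0 i] : set (lebesgue_space R n)).
Proof.
apply: le_caratheodory_measurable => X.
apply: le_ereal_inf_tmp => _ [p Xp <-].
have vol_ge0 (q : 'rV[R]_n.+1 * 'rV[R]_n.+1) : (0 <= (box_volume q)%:E)%E.
  by rewrite lee_fin box_volume_ge0.
rewrite (eq_eseriesr (g := fun k => (box_volume (box_cut_above (p k) i c))%:E +
    (box_volume (box_cut_below (p k) i c))%:E)%E); last first.
  by move=> k _; rewrite -EFinD box_volume_cut.
rewrite nneseriesD//; apply: leeD.
  apply: ereal_inf_lbound; exists (fun k => box_cut_above (p k) i c) => //.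
  move=> x [/Xp[k _ pkx] /= cx]; exists k => // j /=.
  move: (pkx j); rewrite !in_itv/= mxE; case: eqP => [->|//] /andP[? ->].
  by rewrite gt_max cx andbT; apply/andP.
apply: ereal_inf_lbound; exists (fun k => box_cut_below (p k) i c) => //.
move=> x [/Xp[k _ pkx] /= /negP]; rewrite -leNgt => xc; exists k => // j /=.
move: (pkx j); rewrite !in_itv/= mxE; case: eqP => [->|//] /andP[-> ?].
by rewrite le_min xc.
Qed.

Lemma measurable_coord (i : 'I_n.+1) :
  measurable_fun [set: lebesgue_space R n]
    ((fun x : 'rV[R]_n.+1 => x ord0 i) : lebesgue_space R n -> R).
Proof.
apply: (measurability _ (RGenOInfty.measurableE R)).
move=> _ [_ [c ->] <-]; rewrite setTI.
rewrite (_ : _ @^-1` _ = [set x : 'rV[R]_n.+1 | c < x ord0 i]); last first.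
  by apply/seteqP; split => x /=; rewrite in_itv/= andbT.
exact: measurable_halfspace_gt.
Qed.

Lemma measurable_orthotope (I : 'I_n.+1 -> interval R) :
  measurable ([set x : 'rV[R]_n.+1 | forall i, x ord0 i \in I i]
    : set (lebesgue_space R n)).
Proof.
rewrite (_ : [set x | _] = \bigcap_(i in [set: 'I_n.+1])
    ((fun x : 'rV[R]_n.+1 => x ord0 i) @^-1` [set` I i])); last first.
  by apply/seteqP; split => x xI i => [_|]; exact: xI.
apply: fin_bigcap_measurable; first exact: finite_finset.
by move=> i _; rewrite -[X in measurable X]setTI; apply: measurable_coord.
Qed.

End outer_lebesgue_basics.

(** * Dyadic cubes *)

Section cubes.
Context {R : realType} {n : nat}.

(** Cubes as data: subdivision computes with the corner, side and faces, which [is_cube] only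
    asserts to exist. *)
Record cube := Cube {
  cube_corner : 'rV[R]_n.+1;
  cube_side : R;
  lower_face : 'I_n.+1 -> bool;
  upper_face : 'I_n.+1 -> bool }.

Definition cube_itv c i : interval R :=
  Interval (BSide (lower_face c i) (cube_corner c ord0 i))
           (BSide (upper_face c i) (cube_corner c ord0 i + cube_side c)).

Definition cube_set c : set (lebesgue_space R n) :=
  [set x : 'rV[R]_n.+1 | forall i, x ord0 i \in cube_itv c i].

Lemma is_cubeP (Q : set (lebesgue_space R n)) :
  is_cube Q <-> exists2 c, 0 < cube_side c & Q = cube_set c.
Proof.
split=> [[a [l [s [t [l0 ->]]]]]|[[a l s t] l0 ->]].
  by exists (Cube a l s t).
by exists a, l, s, t.
Qed.

Lemma measurable_cube c : measurable (cube_set c).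
Proof. exact: measurable_orthotope. Qed.

Lemma cube_itv_le c i x : x \in cube_itv c i ->
  cube_corner c ord0 i <= x <= cube_corner c ord0 i + cube_side c.
Proof.
by rewrite /cube_itv; case: lower_face; case: upper_face;
  rewrite in_itv/= => /andP[? ?]; apply/andP; split => //; apply/ltW.
Qed.

Lemma cube_itv_lt c i x :
  cube_corner c ord0 i < x < cube_corner c ord0 i + cube_side c ->
  x \in cube_itv c i.
Proof.
by rewrite /cube_itv; case: lower_face; case: upper_face;
  rewrite in_itv/= => /andP[? ?]; apply/andP; split => //; apply/ltW.
Qed.

Lemma cube_measure_lty c : (lebesgue_mx (cube_set c) < +oo)%E.
Proof.
(* Boxes are open below; lowering the corner by 1 captures a closed lower face. *)
pose p := (\row_i (cube_corner c ord0 i - 1),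
           \row_i (cube_corner c ord0 i + cube_side c)).
apply: (@le_lt_trans _ _ (box_volume p)%:E); last exact: ltry.
apply: le_trans (outer_lebesgue_box p); apply: le_outer_measure => x cx i.
have /andP[? ?] := cube_itv_le (cx i).
by rewrite in_itv/= !mxE; apply/andP; split => //; lra.
Qed.

Lemma cube_measure_fin_num c : lebesgue_mx (cube_set c) \is a fin_num.
Proof. by rewrite ge0_fin_numE// cube_measure_lty. Qed.

(** A face flag [true] means closed below, open above. The middle hyperplane thus goes to the upper
    half in each coordinate, and the children partition the cube whatever its outer faces. *)
Definition dyadic_child c (b : {ffun 'I_n.+1 -> bool}) :=
  Cube (\row_i (cube_corner c ord0 i + if b i then cube_side c / 2 else 0))
       (cube_side c / 2)
       (fun i => b i || lower_face c i) (fun i => ~~ b i || upper_face c i).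

Lemma dyadic_childE c b : 0 < cube_side c ->
  cube_set (dyadic_child c b) = cube_set c `&`
  [set x : 'rV[R]_n.+1 | forall i,
    (cube_corner c ord0 i + cube_side c / 2 <= x ord0 i) = b i].
Proof.
move=> c0.
have E i (x : R) : (x \in cube_itv (dyadic_child c b) i) =
    (x \in cube_itv c i) &&
    ((cube_corner c ord0 i + cube_side c / 2 <= x) == b i).
  rewrite /cube_itv /= mxE.
  case: (b i) => /=; case: lower_face; case: upper_face;
    rewrite !in_itv/=; do ?case: ltP => ?; do ?case: leP => ? //=;
    rewrite ?eqxx//=; exfalso; lra.
apply/seteqP; split => [x xb|x [xc xb] i]; last first.
  by move: (xb i) => /= /eqP xbi; rewrite E xbi andbT; exact: xc.
by split => i; move: (xb i); rewrite E => /andP[? /eqP].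
Qed.

Lemma sum_dyadic_child c (A : set (lebesgue_space R n)) :
  0 < cube_side c -> measurable A ->
  (\sum_b lebesgue_mx (A `&` cube_set (dyadic_child c b)) =
   lebesgue_mx (A `&` cube_set c))%E.
Proof.
move=> c0 mA.
have <- : \bigcup_(b in [set: {ffun 'I_n.+1 -> bool}])
    (A `&` cube_set (dyadic_child c b)) = A `&` cube_set c.
  apply/seteqP; split=> [x [b _ [Ax]]|x [Ax cx]].
    by rewrite dyadic_childE// => -[].
  exists [ffun i => cube_corner c ord0 i + cube_side c / 2 <=
                    (x : 'rV[R]_n.+1) ord0 i] => //.
  by split => //; rewrite dyadic_childE//; split => // i; rewrite ffunE.
rewrite measure_fin_bigcup//.
- rewrite fsbig_seq ?index_enum_uniq//; apply: eq_fsbigl.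
  by apply/seteqP; split => // b _ /=; rewrite mem_index_enum.
- exact: finite_finset.
- apply/trivIsetP => b b' _ _ /eqP bb'; apply: contrapT => /eqP/set0P[x].
  rewrite !dyadic_childE// => -[[_ [_ xb]] [_ [_ xb']]]; apply: bb'.
  by apply/ffunP => i; rewrite -xb -xb'.
- by move=> b _; apply: measurableI => //; exact: measurable_cube.
Qed.

Lemma dyadic_child_sub c b : 0 < cube_side c ->
  cube_set (dyadic_child c b) `<=` cube_set c.
Proof. by move=> c0; rewrite dyadic_childE// => x []. Qed.

Lemma outer_measure_bigcup_finType (I : finType)
    (mu : {outer_measure set 'rV[R]_n.+1 -> \bar R})
    (F : I -> set 'rV[R]_n.+1) :
  (mu (\bigcup_i F i) <= \sum_i mu (F i))%E.
Proof.
rewrite (_ : \bigcup_i F i = \big[setU/set0]_i F i); last first.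
  rewrite -bigcup_seq; apply: eq_bigcup => //.
  by split => // i _; rewrite /= mem_index_enum.
elim/big_ind2 : _ => //; first by rewrite outer_measure0.
by move=> A x B y Ax By; apply: (le_trans (outer_measureU2 _ _ _)); exact: leeD.
Qed.

(* Translates of the half-size cube by steps of a third of the side: comparing
   them with the large cube avoids computing the measure of a cube. *)
Lemma cube_half_measure c c' : 0 < cube_side c ->
  cube_side c' = cube_side c / 2 ->
  (lebesgue_mx (cube_set c) <=
   (3 ^+ n.+1)%:E * lebesgue_mx (cube_set c'))%E.
Proof.
move=> c0 c'E.
(* In units of the side, the half-size intervals start at -1/12, 3/12 and 7/12. Their interiors
   contain the three closed thirds, so the covering holds for any faces. *)
pose v (f : {ffun 'I_n.+1 -> 'I_3}) : 'rV[R]_n.+1 := \row_i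
  (cube_corner c ord0 i - cube_corner c' ord0 i +
   cube_side c * (4 * (f i)%:R - 1) / 12).
have cov : cube_set c `<=` \bigcup_f [set x + v f | x in cube_set c'].
  move=> x cx.
  pose u i := (x : 'rV[R]_n.+1) ord0 i - cube_corner c ord0 i.
  pose k i := if u i < cube_side c / 3 then 0%N else
              if u i < cube_side c * 2 / 3 then 1%N else 2%N.
  have k3 i : (k i < 3)%N by rewrite /k; do !case: ifP.
  pose f := [ffun i => Ordinal (k3 i)].
  exists f => //; exists ((x : 'rV[R]_n.+1) - v f); last by rewrite subrK.
  move=> i; apply: cube_itv_lt; rewrite c'E !mxE ffunE /= /k.
  have /andP[] := cube_itv_le (cx i).
  rewrite (_ : (x : 'rV[R]_n.+1) ord0 i = cube_corner c ord0 i + u i);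
    last by rewrite /u; lra.
  by case: (ltP (u i) (cube_side c / 3)) => ?;
    [|case: (ltP (u i) (cube_side c * 2 / 3)) => ?]; move=> ? ?;
    apply/andP; split; lra.
apply: le_trans (le_outer_measure _ _ _ cov) _.
apply: le_trans (outer_measure_bigcup_finType _ _) _.
rewrite (eq_bigr (fun=> lebesgue_mx (cube_set c'))); last first.
  by move=> f _; exact: outer_lebesgue_translate.
have /fineK <- := cube_measure_fin_num c'.
by rewrite sumEFin sumr_const card_ffun !card_ord -EFinM -natrX mulr_natl lexx.
Qed.

End cubes.

(** * Sets that are sparse in every dyadic cube *)

Section density.
Context {R : realType} {n : nat}.
Implicit Types (c : @cube R n) (N : set (lebesgue_space R n)).

(** Words are read from the root: the descendants of child [b] are those with words [b :: w]. *)
Definition descendant c w := foldl dyadic_child c w.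

Lemma descendant_side_gt0 c w : 0 < cube_side c ->
  0 < cube_side (descendant c w).
Proof. by elim: w c => [//|b w IH] c c0 /=; apply: IH; rewrite divr_gt0. Qed.

Lemma descendant_sub c w : 0 < cube_side c ->
  cube_set (descendant c w) `<=` cube_set c.
Proof.
elim: w c => [c _ x|b w IH c c0] //=.
apply: (subset_trans _ (dyadic_child_sub c0)); apply: IH.
by rewrite divr_gt0.
Qed.

Definition box_enlarge (r : R) (p : 'rV[R]_n.+1 * 'rV[R]_n.+1) :=
  (\row_i (p.1 ord0 i - r), \row_i (p.2 ord0 i + r)).

Definition sparse (theta : R) N c := forall w,
  (lebesgue_mx (N `&` cube_set (descendant c w)) <=
   theta%:E * lebesgue_mx (cube_set (descendant c w)))%E.

Lemma measurable_box p : measurable (box p : set (lebesgue_space R n)).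
Proof. exact: (measurable_orthotope (fun i => `]p.1 ord0 i, p.2 ord0 i])). Qed.

(** After [m] halvings the side is at most [r]. A cube that small which meets the box lies in the
    enlarged box, where its sparseness bound is charged; larger cubes follow by summing over
    children. *)
Lemma sparse_box_enlarge theta N p r c m : 0 <= theta -> measurable N ->
  0 < cube_side c -> cube_side c <= r * 2 ^+ m -> sparse theta N c ->
  (lebesgue_mx (N `&` box p `&` cube_set c) <=
   theta%:E * lebesgue_mx (box (box_enlarge r p) `&` cube_set c))%E.
Proof.
move=> theta0 mN; elim: m c => [|m IH] c c0 cr sp.
  rewrite expr0 mulr1 in cr.
  have [->|/set0P[x [[_ px] cx]]] := eqVneq (N `&` box p `&` cube_set c) set0.
    by rewrite measure0 mule_ge0.
  have cp : cube_set c `<=` box (box_enlarge r p).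
    move=> y cy i; rewrite in_itv/= !mxE.
    have /andP[? ?] := cube_itv_le (cx i).
    have /andP[? ?] := cube_itv_le (cy i).
    have := px i; rewrite in_itv/= => /andP[? ?].
    by apply/andP; split; lra.
  rewrite (setIidr cp); apply: le_trans (sp [::]).
  by apply: le_outer_measure => y [[]].
rewrite -!sum_dyadic_child//; last 2 first.
- exact: measurable_box.
- by apply: measurableI => //; exact: measurable_box.
rewrite ge0_sume_distrr//; apply: lee_sum => b _; apply: IH.
- by rewrite divr_gt0.
- by rewrite /= ler_pdivrMr// -mulrA -exprSr.
- by move=> w; exact: sp (b :: w).
Qed.

Lemma sparse_box theta N p c : 0 <= theta -> measurable N ->
  0 < cube_side c -> N `<=` cube_set c -> sparse theta N c ->
  (lebesgue_mx (N `&` box p) <= (theta * 3 ^+ n.+1 * box_volume p)%:E)%E.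
Proof.
move=> theta0 mN c0 Nc sp.
have [->|/set0P[x [_ px]]] := eqVneq (N `&` box p) set0.
  by rewrite measure0 lee_fin !mulr_ge0 ?exprn_ge0 ?box_volume_ge0.
have p_gt0 i : 0 < p.2 ord0 i - p.1 ord0 i.
  by have := px i; rewrite in_itv/= => /andP[? ?]; lra.
(* Since [r] is at most every edge, enlarging by [r] on both sides at most triples each edge, hence
   the factor [3 ^+ n.+1]. *)
pose r := \big[Num.min/1]_i (p.2 ord0 i - p.1 ord0 i).
have r0 : 0 < r by rewrite lt_bigmin// ltr01; apply/allP => i _ /=.
have rp i : r <= p.2 ord0 i - p.1 ord0 i by exact: bigmin_le_cond.
have [m cm] : exists m, cube_side c <= r * 2 ^+ m.
  exists (Num.bound (cube_side c / r)); rewrite -ler_pdivrMl// mulrC.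
  exact/ltW/upper_nthrootP.
rewrite -(setIidl Nc) setIAC.
apply: le_trans (sparse_box_enlarge _ theta0 mN c0 cm sp) _.
rewrite -mulrA EFinM lee_wpmul2l//.
apply: (@le_trans _ _ (outer_lebesgue R n (box (box_enlarge r p)))).
  by apply: le_outer_measure => y [].
apply: le_trans (outer_lebesgue_box _) _; rewrite lee_fin.
have -> : 3 ^+ n.+1 = \prod_(i < n.+1) (3 : R) by rewrite prodr_const card_ord.
rewrite /box_volume -big_split/=; apply: ler_prod => i _.
rewrite le_max lexx/= !mxE; have := rp i; have := p_gt0 i => p0 rpi.
by do !rewrite max_r; lra.
Qed.

(** Every cover of [N] by boxes has total volume at least 2|N|, so the infimum gives 2|N| <= |N|;
    inside a cube |N| is finite. *)
Lemma sparse_null theta N c : 0 <= theta -> theta * 3 ^+ n.+1 <= 2^-1 ->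
  measurable N -> 0 < cube_side c -> N `<=` cube_set c -> sparse theta N c ->
  lebesgue_mx N = 0%E.
Proof.
move=> theta0 theta3 mN c0 Nc sp.
have Nfin : lebesgue_mx N \is a fin_num.
  rewrite ge0_fin_numE//; apply: le_lt_trans (cube_measure_lty c).
  exact: le_outer_measure.
suff : (2%:E * lebesgue_mx N <= lebesgue_mx N)%E.
  have : (0 <= lebesgue_mx N)%E by exact: measure_ge0.
  by rewrite -(fineK Nfin) -EFinM !lee_fin => ? ?; congr EFin; lra.
apply: le_ereal_inf_tmp => _ [p Np <-].
have vol_ge0 (q : 'rV[R]_n.+1 * 'rV[R]_n.+1) : (0 <= (box_volume q)%:E)%E.
  by rewrite lee_fin box_volume_ge0.
suff : (lebesgue_mx N <= (2^-1)%:E * \sum_(k <oo) (box_volume (p k))%:E)%E.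
  move=> /(lee_wpmul2l (x := 2%:E)) => /(_ _)/le_trans; apply; first by [].
  by rewrite muleA -EFinM divff// mul1e.
have NE : N = \bigcup_k (N `&` box (p k)).
  by rewrite -setI_bigcupr; apply/esym/setIidl.
rewrite {1}NE; apply: le_trans (outer_measure_sigma_subadditive _ _) _.
rewrite -nneseriesZl//; apply: lee_nneseries => // k _.
apply: le_trans (sparse_box _ theta0 mN c0 Nc sp) _.
by rewrite -EFinM lee_fin ler_wpM2r// box_volume_ge0.
Qed.

End density.

(** * Stopping cubes *)

Section stopping.
Context {R : realType} {n : nat}.
Variables (theta : R) (S : set (lebesgue_space R n)).
Hypothesis mS : measurable S.
Implicit Types c : @cube R n.

Definition dense_cube c :=
  (theta%:E * lebesgue_mx (cube_set c) < lebesgue_mx (S `&` cube_set c))%E.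

(** The recursion ends at the first dense cube met, which is therefore maximal. The depth [m] makes
    it structural; the union over [m] collects all stopping cubes. *)
Fixpoint stopped m c : set (lebesgue_space R n) :=
  if `[< dense_cube c >] then cube_set c
  else if m is m'.+1 then \bigcup_b stopped m' (dyadic_child c b) else set0.

Lemma measurable_stopped m c : measurable (stopped m c).
Proof.
elim: m c => [|m IH] c /=; case: ifP => _ //; try exact: measurable_cube.
by apply: fin_bigcup_measurable => // b _; exact: IH.
Qed.

Lemma stopped_nondecreasing c : nondecreasing_seq (stopped^~ c).
Proof.
apply/nondecreasing_seqP => m; apply/subsetPset.
elim: m c => [|m IH] c /=; case: ifP => _ x //.
by move=> [b _ bx]; exists b => //; exact: IH.
Qed.

Lemma dense_descendant_stopped c w : 0 < cube_side c ->
  dense_cube (descendant c w) ->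
  cube_set (descendant c w) `<=` stopped (size w) c.
Proof.
elim: w c => [c c0 dw|b w IH c c0 dw] /=; first by rewrite asboolT.
have c0' : 0 < cube_side (dyadic_child c b) by rewrite divr_gt0.
case: ifPn => [_|_ x xw]; last by exists b => //; exact: IH xw.
apply: (subset_trans _ (dyadic_child_sub c0)).
exact: descendant_sub.
Qed.

Hypothesis thetaE : theta = (2 * 3 ^+ n.+1)^-1.
Variables (E : set (lebesgue_space R n)) (q : R).
Hypotheses (mE : measurable E) (q0 : 0 <= q).

Definition half_empty c :=
  (lebesgue_mx (S `&` cube_set c) <= (2^-1)%:E * lebesgue_mx (cube_set c))%E.

(** The slot for the induction hypothesis of [exceed_decay], where [E] is the level set at step k+1
    and [q] is 2^-k. *)
Definition stopping_bound c := half_empty c -> dense_cube c ->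
  (lebesgue_mx (E `&` cube_set c) <= q%:E * lebesgue_mx (cube_set c))%E.

Let theta_gt0 : 0 < theta.
Proof. by rewrite thetaE invr_gt0 mulr_gt0// exprn_gt0. Qed.

(** The parent has measure at most 3^d times that of the child, and [theta] is chosen so that theta
    * 3^d = 1/2. *)
Lemma half_empty_child c b : 0 < cube_side c -> ~ dense_cube c ->
  half_empty (dyadic_child c b).
Proof.
move=> c0 /negP; rewrite -leNgt => dc.
apply: (@le_trans _ _ (lebesgue_mx (S `&` cube_set c))).
  by apply: le_outer_measure; apply: setIS; exact: dyadic_child_sub.
apply: le_trans dc _.
have /(lee_wpmul2l (x := theta%:E)) :=
  cube_half_measure c0 (erefl (cube_side (dyadic_child c b))).
move=> /(_ _)/le_trans; apply; first by rewrite lee_fin ltW.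
by rewrite muleA -EFinM thetaE invfM -mulrA mulVf ?mulr1.
Qed.

(** On a dense cube, |c| <= |S in c| / theta turns the bound [q] into [q / theta]; elsewhere the
    children are summed, each half empty because its parent is not dense. *)
Lemma stopped_measure m c : 0 < cube_side c ->
  (forall w, stopping_bound (descendant c w)) -> half_empty c ->
  (lebesgue_mx (E `&` stopped m c) <=
   (q / theta)%:E * lebesgue_mx (S `&` cube_set c))%E.
Proof.
have qt0 : 0 <= q / theta by rewrite divr_ge0// ltW.
have bad c' : stopping_bound c' -> half_empty c' -> dense_cube c' ->
    (lebesgue_mx (E `&` cube_set c') <=
     (q / theta)%:E * lebesgue_mx (S `&` cube_set c'))%E.
  move=> sb he dc; apply: le_trans (sb he dc) _.
  rewrite EFinM -muleA lee_wpmul2l//.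
  rewrite -[leLHS]mul1e -(@mulVf _ theta) ?gt_eqF// EFinM -muleA.
  by rewrite lee_wpmul2l// ?lee_fin ?invr_ge0 ltW.
elim: m c => [|m IH] c c0 sb he /=; case: asboolP => dc.
- exact: bad (sb [::]) he dc.
- by rewrite setI0 measure0 mule_ge0.
- exact: bad (sb [::]) he dc.
rewrite setI_bigcupr; apply: le_trans (outer_measure_bigcup_finType _ _) _.
rewrite -sum_dyadic_child// ge0_sume_distrr//; apply: lee_sum => b _.
apply: IH; first by rewrite divr_gt0.
- by move=> w; exact: sb (b :: w).
- exact: half_empty_child.
Qed.

(* The stopping cubes, the maximal dyadic ones on which S has density more than
   theta, cover E up to a null set; as they are disjoint, their total measure
   is at most mu(S) / theta. *)
Lemma stopping_measure c : 0 < cube_side c -> E `<=` S -> S `<=` cube_set c ->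
  (forall w, stopping_bound (descendant c w)) -> half_empty c ->
  (lebesgue_mx E <= (q / theta)%:E * lebesgue_mx S)%E.
Proof.
move=> c0 ES Sc sb he.
pose U := \bigcup_m stopped m c.
have mU : measurable U.
  by apply: bigcupT_measurable => m; exact: measurable_stopped.
have mN : measurable (E `\` U) by exact: measurableD.
(* [E] outside [U] misses every dense descendant, and has density at most [theta] in the others
   because [E] lies in [S]: it is sparse. *)
have N0 : lebesgue_mx (E `\` U) = 0%E.
  apply: (@sparse_null _ _ theta _ c) => //; first exact: ltW.
  - by rewrite thetaE invfM -mulrA mulVf ?mulr1// expf_neq0.
  - by move=> x [/ES/Sc].
  move=> w; have [dw|/negP] := pselect (dense_cube (descendant c w)).
    have -> : (E `\` U) `&` cube_set (descendant c w) = set0.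
      rewrite -subset0 => x [[_ xU] xw]; apply: xU; exists (size w) => //.
      exact: dense_descendant_stopped xw.
    by rewrite measure0; apply: mule_ge0 => //; rewrite lee_fin ltW.
  rewrite -leNgt; apply: le_trans; apply: le_outer_measure.
  by apply: setSI => x [/ES].
have -> : lebesgue_mx E = lebesgue_mx (E `&` U).
  rewrite -[in LHS](setUIDK E U) measureU//.
  - by rewrite [X in (_ + X)%E]N0 adde0.
  - exact: measurableI.
  - by rewrite -subset0 => x [[_ ?] [_ /(_ _)]].
rewrite /U setI_bigcupr.
(* The bound is uniform in the depth, so it passes to the increasing union. *)
have cv : (lebesgue_mx \o (fun m => E `&` stopped m c)) @ \oo -->
    lebesgue_mx (\bigcup_m (E `&` stopped m c)).
  apply: nondecreasing_cvg_mu.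
  - by move=> m; apply: measurableI => //; exact: measurable_stopped.
  - by rewrite -setI_bigcupr; exact: measurableI.
  - move=> i j ij; apply/subsetPset; apply: setIS; apply/subsetPset.
    exact: stopped_nondecreasing.
rewrite -(cvg_lim _ cv)//; apply: lime_le.
  by apply/cvg_ex; eexists; exact: cv.
apply: nearW => m /=; rewrite -[in leRHS](setIidl Sc).
exact: stopped_measure.
Qed.

End stopping.

(** * Decay of the oscillation *)

Section oscillation.
Context {R : realType} {n : nat}.
Variables (Q : set (lebesgue_space R n)) (phi : lebesgue_space R n -> R).
Implicit Types (J : set (lebesgue_space R n)) (c : @cube R n).

Definition exceed J (t : R) := J `&` [set x | t < `|phi x - mean phi J|].

Lemma measurable_exceed J t : measurable J -> measurable_fun J phi ->
  measurable (exceed J t).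
Proof.
move=> mJ mphi.
have mf : measurable_fun J (fun x => `|phi x - mean phi J|).
  by apply: measurableT_comp => //; exact: measurable_funB.
rewrite /exceed (_ : [set x | _] =
    (fun x => `|phi x - mean phi J|) @^-1` `]t, +oo[%classic).
  exact: mf.
by apply/seteqP; split => x /=; rewrite in_itv/= andbT.
Qed.

Hypothesis mphi : measurable_fun Q phi.
Hypothesis mQ : measurable Q.
Variable T : R.
Hypothesis T_gt0 : 0 < T.
Hypothesis exceed_small : forall c, 0 < cube_side c -> cube_set c `<=` Q ->
  (lebesgue_mx (exceed (cube_set c) T) <=
   ((4 * 3 ^+ n.+1)^-1)%:E * lebesgue_mx (cube_set c))%E.

Let T_ge0 : 0 <= T. Proof. exact: ltW. Qed.

Let three_gt0 : 0 < 3 ^+ n.+1 :> R. Proof. exact: exprn_gt0. Qed.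

Let three_ge1 : 1 <= 3 ^+ n.+1 :> R. Proof. by rewrite exprn_ege1// ler1n. Qed.

Lemma mean_close c c' : 0 < cube_side c -> cube_set c `<=` Q ->
  0 < cube_side c' -> cube_set c' `<=` cube_set c ->
  (0 < lebesgue_mx (cube_set c'))%E -> half_empty (exceed (cube_set c) T) c' ->
  `|mean phi (cube_set c) - mean phi (cube_set c')| <= 2 * T.
Proof.
move=> c0 cQ c'0 c'c mc' he.
suff [x [c'x /negP xS /negP xc']] : exists x, [/\ cube_set c' x,
    ~ T < `|phi x - mean phi (cube_set c)| &
    ~ T < `|phi x - mean phi (cube_set c')|].
  rewrite -leNgt in xS; rewrite -leNgt in xc'.
  rewrite (le_trans (ler_distD (phi x) _ _))// distrC; lra.
apply: contrapT => nx.
have : (lebesgue_mx (cube_set c') <=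
    lebesgue_mx (exceed (cube_set c) T `&` cube_set c') +
    lebesgue_mx (exceed (cube_set c') T))%E.
  apply: le_trans (outer_measureU2 _ _ _); apply: le_outer_measure => x c'x.
  have [xS|xS] := pselect (T < `|phi x - mean phi (cube_set c)|).
    by left; split => //; split => //; exact: c'c.
  right; split => //; apply: contrapT => xc'; apply: nx.
  by exists x.
move=> /le_trans/(_ (leeD he (exceed_small c'0 (subset_trans c'c cQ)))).
move: mc'; have /fineK <- := cube_measure_fin_num c'.
rewrite -!EFinM -EFinD lte_fin lee_fin => m0.
(* The two exceptional sets fill at most 1/2 + 1/4 of a cube of positive measure, so they cannot
   cover it. *)
have : (4 * 3 ^+ n.+1)^-1 <= 4^-1 :> R.
  by rewrite lef_pV2 ?posrE ?mulr_gt0// ler_peMr.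
by nra.
Qed.

Lemma exceed_decay k c : 0 < cube_side c -> cube_set c `<=` Q ->
  (lebesgue_mx (exceed (cube_set c) (k%:R * (2 * T))) <=
   (2 ^- k)%:E * lebesgue_mx (cube_set c))%E.
Proof.
elim: k c => [|k IH] c c0 cQ.
  by rewrite expr0 invr1 mul1e; apply: le_outer_measure => x [].
have mc t : measurable (exceed (cube_set c) t).
  apply: measurable_exceed; first exact: measurable_cube.
  exact: measurable_funS mphi.
pose theta : R := (2 * 3 ^+ n.+1)^-1.
have q0 : 0 <= 2 ^- k :> R by rewrite invr_ge0 exprn_ge0.
have he : half_empty (exceed (cube_set c) T) c.
  apply: (@le_trans _ _ (lebesgue_mx (exceed (cube_set c) T))).
    by apply: le_outer_measure => x [].
  apply: le_trans (exceed_small c0 cQ) _; rewrite lee_wpmul2r// lee_fin.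
  by rewrite lef_pV2 ?posrE ?mulr_gt0//; move: three_ge1; lra.
apply: le_trans (stopping_measure (S := exceed (cube_set c) T) (theta := theta)
  (mc _) (erefl _) (mc _) q0 c0 _ _ _ he) _.
- move=> x [cx /= xt]; split => //=; apply: le_lt_trans xt.
  have : 0 <= k%:R * T by rewrite mulr_ge0.
  by rewrite -[k.+1%:R]natr1; move: T_ge0; lra.
- by move=> x [].
- move=> w he' _; set c' := descendant c w.
  have c'0 : 0 < cube_side c' by exact: descendant_side_gt0.
  have c'c : cube_set c' `<=` cube_set c by exact: descendant_sub.
  (* [mean_close] needs positive measure; on a null cube the bound is trivial. *)
  have [m0|] := leP (lebesgue_mx (cube_set c')) 0%E.
    apply: (@le_trans _ _ (lebesgue_mx (cube_set c'))).
      by apply: le_outer_measure => x [].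
    by apply: le_trans m0 _; rewrite mule_ge0.
  move=> /(mean_close c0 cQ c'0 c'c)/(_ he') cc'.
  apply: le_trans (IH c' c'0 (subset_trans c'c cQ)).
  apply: le_outer_measure => x [[cx /= xt] c'x]; split => //=.
  (* Changing the mean costs at most 2T, so level k+1 relative to [c] lies in level k relative to
     [c']. *)
  have := ler_distD (mean phi (cube_set c')) (phi x) (mean phi (cube_set c)).
  rewrite (distrC (mean phi (cube_set c'))).
  by move: xt; rewrite -[k.+1%:R]natr1; lra.
(* The constants combine as 2^-k * (2 * 3^d) / (4 * 3^d) = 2^-(k+1). *)
rewrite EFinM -muleA exprS invfM mulrC EFinM -muleA lee_wpmul2l//.
rewrite /theta invrK.
apply: le_trans (lee_wpmul2l _ (exceed_small c0 cQ)) _.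
  by rewrite lee_fin mulr_ge0// ltW.
rewrite muleA -EFinM lee_wpmul2r// lee_fin invfM mulrACA divff ?gt_eqF// mulr1.
lra.
Qed.

(** A discrete layer-cake estimate with step L = 2T: the oscillation is at most L times the number
    of levels kL it exceeds, and these level sets have total measure at most 2|J|. *)
Lemma oscillation_bound c : 0 < cube_side c -> cube_set c `<=` Q ->
  (\int[lebesgue_mx]_(x in cube_set c) `|phi x - mean phi (cube_set c)|%:E <=
   (4 * T)%:E * lebesgue_mx (cube_set c))%E.
Proof.
move=> c0 cQ; set J := cube_set c; set L := 2 * T.
have L0 : 0 < L by rewrite mulr_gt0.
have mJ : measurable J by exact: measurable_cube.
have mphiJ : measurable_fun J phi by exact: measurable_funS mphi.
have mE k : measurable (exceed J (k%:R * L)) by exact: measurable_exceed.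
pose g k x := (L%:E * (\1_(exceed J (k%:R * L)) x)%:E)%E.
have mg k : measurable_fun J (g k).
  apply: measurable_funeM; apply/measurable_EFinP.
  exact: measurable_indic.
have g0 k x : J x -> (0 <= g k x)%E.
  by move=> _; rewrite mule_ge0// lee_fin// ltW.
apply: (@le_trans _ _ (\int[lebesgue_mx]_(x in J) (\sum_(k <oo) g k x))%E).
  apply: ge0_le_integral => //.
  - apply/measurable_EFinP; apply: measurableT_comp => //.
    exact: measurable_funB.
  - by apply: ge0_emeasurable_sum => [k x Jx _|k _]; [exact: g0|exact: mg].
  move=> x Jx; set f := `|phi x - mean phi J|.
  (* With [m] least, [x] lies in the first [m] level sets, which contribute mL >= f. *)
  have [m fm mmin] : exists2 m, f <= m%:R * L &
      forall k, (k < m)%N -> k%:R * L < f.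
    have exm : exists m, f <= m%:R * L.
      exists (Num.bound (f / L)); rewrite -ler_pdivrMr//.
      by apply/ltW/archi_boundP; apply: divr_ge0; [exact: normr_ge0|exact: ltW].
    exists (ex_minn exm); case: ex_minnP => // m fm mmin k km.
    by rewrite ltNge; apply/negP => /mmin; rewrite leqNgt km.
  apply: le_trans (nneseries_lim_ge m _); last by move=> k _ _; exact: g0.
  rewrite (eq_big_nat _ _ (F2 := fun=> L%:E)) => [|k /andP[_ km]].
    by rewrite sumEFin big_const_nat iter_addr_0 subn0 -mulr_natl lee_fin.
  rewrite /g indicE mem_set ?mule1//; split => //=; exact: mmin.
rewrite integral_nneseries//.
(* 2^-k is written as 2 / 2^(k+1), the form summed by [epsilon_trick0]. *)
apply: (@le_trans _ _ (\sum_(k <oo)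
    ((2 * L * fine (lebesgue_mx J)) / (2 ^ k.+1)%:R)%:E)%E).
  apply: lee_nneseries => [k _ _|k _].
    by apply: integral_ge0 => x; exact: g0.
  have mi : measurable_fun J (fun x => (\1_(exceed J (k%:R * L)) x : R)%:E).
    by apply/measurable_EFinP; exact: measurable_indic.
  rewrite (ge0_integralZl lebesgue_mx mJ mi) //;
    [|by rewrite lee_fin ltW].
  rewrite integral_indic// (setIidl (_ : exceed _ _ `<=` J));
    last by move=> x [].
  apply: le_trans (lee_wpmul2l _ (exceed_decay k c0 cQ)) _.
    by rewrite lee_fin ltW.
  have /fineK <- := cube_measure_fin_num c.
  rewrite -!EFinM lee_fin natrX exprS invfM -/J.
  by set b := (2 ^+ k)^-1; lra.
apply: le_trans (epsilon_trick0 _ _) _.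
  by rewrite mulr_ge0 ?fine_ge0// mulr_ge0// ltW.
have /fineK {2}<- := cube_measure_fin_num c.
by rewrite -EFinM lee_fin /L -/J; lra.
Qed.

End oscillation.

(** * Averages *)

Section average_bounds.
Context {R : realType} {n : nat}.
Implicit Types (c : @cube R n) (f : lebesgue_space R n -> \bar R).

(* A null cube is no exception: there the average is +oo * 0 = 0. *)
Lemma average_le f c (M : R) : (forall x, cube_set c x -> 0 <= f x)%E ->
  (\int[lebesgue_mx]_(x in cube_set c) f x <=
   M%:E * lebesgue_mx (cube_set c))%E -> 0 <= M ->
  (average f (cube_set c) <= M%:E)%E.
Proof.
move=> f0 + M0; rewrite /average.
have : (0 <= \int[lebesgue_mx]_(x in cube_set c) f x)%E by exact: integral_ge0.
have : (0 <= lebesgue_mx (cube_set c))%E by [].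
have /fineK <- := cube_measure_fin_num c; set m := fine _.
rewrite lee_fin le_eqVlt => /predU1P[<- I0 IM|m0 _ IM].
  rewrite mule0 in IM.
  have -> : (\int[lebesgue_mx]_(x in cube_set c) f x = 0)%E.
    by apply/eqP; rewrite eq_le IM.
  by rewrite mule0 lee_fin.
by rewrite inver gt_eqF// lee_pdivrMl// muleC.
Qed.

Lemma integral_le_average f c (M : R) : measurable_fun (cube_set c) f ->
  (average f (cube_set c) <= M%:E)%E ->
  (\int[lebesgue_mx]_(x in cube_set c) f x <=
   M%:E * lebesgue_mx (cube_set c))%E.
Proof.
move=> mf; rewrite /average.
have [m0|m0] := eqVneq (lebesgue_mx (cube_set c)) 0%E.
  by rewrite m0 mule0 null_set_integral//; exact: measurable_cube.
have : (0 < lebesgue_mx (cube_set c))%E by rewrite lt_neqAle eq_sym m0/=.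
have /fineK <- := cube_measure_fin_num c; rewrite lte_fin => m1.
by rewrite inver gt_eqF// lee_pdivrMl// muleC.
Qed.

(** Chebyshev without monotonicity of [h]: divergence alone gives a threshold beyond which h >= B,
    so B|E| <= M|c|. *)
Lemma exceed_chebyshev (h : R -> R) (Q : set (lebesgue_space R n))
    (phi : lebesgue_space R n -> R) (eps : R) :
  (forall t : R, 0 <= t -> 0 <= h t) -> h t @[t --> +oo] --> +oo ->
  measurable Q -> measurable_fun Q phi -> K_finite h Q phi -> 0 < eps ->
  exists2 T, 0 < T & forall c, 0 < cube_side c -> cube_set c `<=` Q ->
    (lebesgue_mx (exceed phi (cube_set c) T) <=
     eps%:E * lebesgue_mx (cube_set c))%E.
Proof.
move=> h0 hoo mQ mphi [mosc Kfin] eps0.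
have [M M0 KM] : exists2 M : R, 0 <= M & (K h Q phi <= M%:E)%E.
  case: (K h Q phi) Kfin => [r _|//|_]; last by exists 0; rewrite ?leNye.
  by exists (Num.max 0 r); rewrite ?lee_fin le_max lexx ?orbT.
(* This makes M / B <= eps; the 1 keeps [B] positive when M = 0. *)
pose B := M / eps + 1.
have B0 : 0 < B by rewrite ltr_wpDl// divr_ge0// ltW.
have /cvgryPge/(_ B)[T0 [_ hB]] := hoo.
exists (Num.max 1 T0); first by rewrite lt_max ltr01.
move=> c c0 cQ; set E := exceed _ _ _.
have mc := measurable_cube c.
have Jc : subcubes Q (cube_set c) by split=> //; apply/is_cubeP; exists c.
have mE : measurable E.
  by apply: measurable_exceed => //; exact: measurable_funS mphi.
have mo : measurable_fun (cube_set c) (EFin \o osc h phi (cube_set c)).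
  by apply/measurable_EFinP; exact: mosc.
have : (B%:E * lebesgue_mx E <= M%:E * lebesgue_mx (cube_set c))%E.
  apply: (le_trans _ (integral_le_average mo _)); last first.
    by apply: le_trans KM; apply: ereal_sup_ubound; exists (cube_set c).
  have EJ : E `<=` cube_set c by move=> x [].
  have o0 x : cube_set c x -> (0 <= (EFin \o osc h phi (cube_set c)) x)%E.
    by move=> _; rewrite lee_fin h0.
  apply: (@le_trans _ _ (\int[lebesgue_mx]_(x in E)
      (EFin \o osc h phi (cube_set c)) x)%E); last exact: ge0_subset_integral.
  rewrite -integral_cst//; apply: ge0_le_integral => //.
  - by move=> x _; rewrite lee_fin ltW.
  - by apply: measurable_funS mo => // x [].
  - move=> x [_ /= xT]; rewrite lee_fin; apply: hB.
    by apply: le_lt_trans xT; rewrite le_max lexx orbT.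
rewrite -lee_pdivlMl// muleA -EFinM => /le_trans; apply.
rewrite lee_wpmul2r// lee_fin ler_pdivrMl// /B.
by rewrite mulrDl divfK ?gt_eqF// mul1r lerDl ltW.
Qed.

End average_bounds.

Theorem theorem1p6 (R : realType) (n : nat) (h : R -> R)
    (Q : set (lebesgue_space R n)) (phi : lebesgue_space R n -> R) :
  (forall t : R, 0 <= t -> 0 <= h t) ->
  measurable_fun (`[0, +oo[ : set (lebesgue_line R)) (h : lebesgue_line R -> R) ->
  h t @[t --> +oo] --> +oo ->
  is_cube Q ->
  L1 Q phi ->
  K_finite h Q phi ->
  BMO Q phi.
Proof.
move=> h0 _ hoo [a [l [s [t [l0 QE]]]]] L1Q KQ; split=> //.
have mQ : measurable Q by rewrite QE; exact: measurable_orthotope.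
have mphi : measurable_fun Q phi.
  by apply/measurable_EFinP; case/integrableP: L1Q.
(* The smallness that [oscillation_bound] asks for; 4T then bounds every mean oscillation. *)
have eps0 : 0 < (4 * 3 ^+ n.+1)^-1 :> R.
  by rewrite invr_gt0 mulr_gt0// exprn_gt0.
have [T T0 small] := exceed_chebyshev h0 hoo mQ mphi KQ eps0.
apply: (@le_lt_trans _ _ (4 * T)%:E); last exact: ltry.
apply: ge_ereal_sup => _ [J [/is_cubeP[c c0 ->] cQ] <-].
apply: average_le => [x _||]; rewrite ?lee_fin//.
- exact: (oscillation_bound mphi mQ T0 small).
- by rewrite mulr_ge0// ltW.
Qed.
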